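(* Let $n \geq 3$. Suppose $(\mu, \Sigma)$ and $(\mu', \Sigma')$ both satisfy the normalization below. Let $X \sim \mathcal{N}(\mu,\Sigma)$ and $X' \sim \mathcal{N}(\mu',\Sigma')$, and suppose that for all pairwise distinct $i,j,k \in [n]$, $$\Pr\{X_i \geq X_j \geq X_k\} = \Pr\{X'_i \geq X'_j \geq X'_k\}.$$ Then $\mu = \mu'$ and $\Sigma = \Sigma'$. In words, $(\mu,\Sigma)$ is uniquely identifiable from the three-way observation probabilities.
   Context: Probit model: utilities $X \sim \mathcal{N}(\mu, \Sigma)$ with $\mu \in \mathbb{R}^n$ and $\Sigma\in\mathbb{R}^{n\times n}$ symmetric positive semidefinite. Normalization: $\langle \mu, \mathbf{1}\rangle = 0$, $\Sigma\mathbf{1} = 0$, $\operatorname{Tr}(\Sigma) = n$, and $\operatorname{rank}(\Sigma) = n-1$. *)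

(* Defs.v *)
From HB Require Import structures.
From mathcomp Require Import all_boot all_order all_algebra.
From mathcomp Require Import all_classical all_reals all_analysis.
Set Implicit Arguments. Unset Strict Implicit. Unset Printing Implicit Defensive.
Import Order.TTheory GRing.Theory Num.Theory.
Local Open Scope classical_set_scope.
Local Open Scope ring_scope.

(* Univariate Gaussian law with mean m and variance v >= 0, including the
   degenerate case v = 0 (Dirac mass at m).  Note: the library's
   [normal_prob m 0] is NOT a Dirac mass, hence the case split. *)
Definition gauss_law {R : realType} (m v : R) : set R -> \bar R :=
  if v == 0 then (dirac m : set R -> \bar R) else normal_prob m (Num.sqrt v).

Definition probit_normalized {R : realType} (n : nat)
    (mu : 'cV[R]_n) (Sigma : 'M[R]_n) : Prop :=
  [/\ Sigma^T = Sigma,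
      (forall v : 'cV[R]_n, 0 <= (v^T *m Sigma *m v) 0 0),
      \sum_(i < n) mu i 0 = 0,
      Sigma *m (const_mx 1 : 'cV[R]_n) = 0
    & \tr Sigma = n%:R /\ \rank Sigma = n.-1].

(* X = (X_i)_{i<n}, a random vector on the probability space (T, P), is
   multivariate normal N(mu, Sigma) (possibly degenerate): its coordinates
   are measurable and every linear combination t^T X is (univariate) normal
   with mean t^T mu and variance t^T Sigma t  (Cramer-Wold definition). *)
Definition is_mvnormal {R : realType} (n : nat) {d : measure_display}
    {T : measurableType d} (P : probability T R) (X : 'I_n -> T -> R)
    (mu : 'cV[R]_n) (Sigma : 'M[R]_n) : Prop :=
  (forall i, measurable_fun setT (X i)) /\
  forall (t : 'cV[R]_n) (A : set R), measurable A ->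
    P ((fun w => \sum_(i < n) t i 0 * X i w) @^-1` A) =
    gauss_law ((t^T *m mu) 0 0) ((t^T *m Sigma *m t) 0 0) A.

Definition prob3 {R : realType} (n : nat) {d : measure_display}
    {T : measurableType d} (P : probability T R) (X : 'I_n -> T -> R)
    (i j k : 'I_n) : \bar R :=
  P [set w | X j w <= X i w /\ X k w <= X j w].

(* Main.v *)
Require Import Defs.
From HB Require Import structures.
From mathcomp Require Import all_boot all_order all_algebra.
From mathcomp Require Import all_classical all_reals all_analysis.
From mathcomp Require Import measurable_realfun ring lra.
Set Implicit Arguments.
Unset Strict Implicit.

Import Order.TTheory GRing.Theory Num.Theory.
Import numFieldNormedType.Exports.
Local Open Scope classical_set_scope.
Local Open Scope ring_scope.

(** The differences X_i - X_j are Gaussian. Summing three-way probabilities over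
    the position of a third alternative gives Pr(X_i >= X_j), hence the ratio
    mean / standard deviation of X_i - X_j. For fixed such ratios,
    Pr(X_i >= X_j >= X_k) is strictly increasing in the correlation of
    X_i - X_j and X_j - X_k, so it determines that correlation. Viewing the
    utilities as points of a Euclidean space with squared distances
    Var(X_i - X_j), all angles of all triangles are thus known; the triangles
    being nondegenerate by the rank hypothesis, the configuration is known up to
    a scale, which the trace fixes.

    The laws given by one-dimensional projections are compared with a standard
    Gaussian pair through a Cramer-Wold argument: the bounded functions whose
    products with all waves cos(s Y1 + t Y2 + c) have the same expectation on
    both sides are closed under bounded pointwise limits, and the sign function
    is reached from the waves by iterating y |-> (3 y - y^3) / 2 and by
    sg x = lim sg (sin (x / 2^k)). *)

(** * Bounded measurable functions *)

Section BoundedMeasurable.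
Context {R : realType} {d : measure_display} {T : measurableType d}.
Implicit Types f g : T -> R.

Definition bounded_mfun f :=
  measurable_fun setT f /\ exists M : R, forall x, `|f x| <= M.

Lemma bounded_mfun_cst (c : R) : bounded_mfun (fun=> c).
Proof. by split; [exact: measurable_cst | exists `|c|]. Qed.

Lemma bounded_mfunD f g : bounded_mfun f -> bounded_mfun g ->
  bounded_mfun (fun x => f x + g x).
Proof.
move=> [mf [M fM]] [mg [N gN]]; split; first exact: measurable_funD.
exists (M + N) => x; apply: le_trans (ler_normD _ _) _.
exact: lerD.
Qed.

Lemma bounded_mfunM f g : bounded_mfun f -> bounded_mfun g ->
  bounded_mfun (fun x => f x * g x).
Proof.
move=> [mf [M fM]] [mg [N gN]]; split; first exact: measurable_funM.
by exists (M * N) => x; rewrite normrM ler_pM.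
Qed.

Lemma bounded_mfun_lim (f_ : nat -> T -> R) f (M : R) :
  (forall n, bounded_mfun (f_ n)) -> (forall n x, `|f_ n x| <= M) ->
  (forall x, f_ ^~ x @ \oo --> f x) -> bounded_mfun f.
Proof.
move=> bf fM ff; split.
  by apply: (@measurable_fun_cvg _ _ _ setT f_) => // m; case: (bf m).
exists M => x.
have h : `|f_ n x| @[n --> \oo] --> `|f x| by exact: cvg_norm.
rewrite -(cvg_lim _ h)//; apply: limr_le; first by apply/cvg_ex; exists `|f x|.
by apply: nearW => n.
Qed.

Lemma bounded_mfun_integrable (P : probability T R) f :
  bounded_mfun f -> P.-integrable setT (EFin \o f).
Proof.
move=> [mf [M fM]]; apply: measurable_bounded_integrable => //.
  by rewrite (le_lt_trans (probability_le1 _ _))// ltry.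
exists M; split; first exact: num_real.
by move=> x Mx y _; exact: le_trans (fM y) (ltW Mx).
Qed.

End BoundedMeasurable.

(** * Equality of expectations across two probability spaces *)

Section SameExpectation.
Context {R : realType}.
Context {d : measure_display} {T : measurableType d} (P : probability T R).
Context {d' : measure_display} {T' : measurableType d'} (P' : probability T' R).

Definition same_expectation (f : T -> R) (f' : T' -> R) :=
  [/\ bounded_mfun f, bounded_mfun f' &
      (\int[P]_x (f x)%:E = \int[P']_x (f' x)%:E)%E].

Lemma same_expectationD f f' g g' :
  same_expectation f f' -> same_expectation g g' ->
  same_expectation (fun x => f x + g x) (fun x => f' x + g' x).
Proof.
move=> [bf bf' ff'] [bg bg' gg']; split; [exact: bounded_mfunD..|].
under eq_integral do rewrite EFinD.
under [RHS]eq_integral do rewrite EFinD.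
rewrite !integralD//= ?ff' ?gg'//; exact: bounded_mfun_integrable.
Qed.

Lemma same_expectationZ (c : R) f f' : same_expectation f f' ->
  same_expectation (fun x => c * f x) (fun x => c * f' x).
Proof.
move=> [bf bf' ff']; split.
- by apply: bounded_mfunM => //; exact: bounded_mfun_cst.
- by apply: bounded_mfunM => //; exact: bounded_mfun_cst.
- under eq_integral do rewrite EFinM.
  under [RHS]eq_integral do rewrite EFinM.
  rewrite !integralZl//= ?ff'//; exact: bounded_mfun_integrable.
Qed.

(** Dominated convergence on each side, the constant [M] being integrable for a probability. *)
Lemma same_expectation_lim (f_ : nat -> T -> R) (f_' : nat -> T' -> R) f f' M :
  (forall n, same_expectation (f_ n) (f_' n)) ->
  (forall n x, `|f_ n x| <= M) -> (forall n x, `|f_' n x| <= M) ->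
  (forall x, f_ ^~ x @ \oo --> f x) -> (forall x, f_' ^~ x @ \oo --> f' x) ->
  same_expectation f f'.
Proof.
move=> Ef bf bf' cf cf'.
have Bf : bounded_mfun f by apply: bounded_mfun_lim bf cf => n; case: (Ef n).
have Bf' : bounded_mfun f' by apply: bounded_mfun_lim bf' cf' => n; case: (Ef n).
split=> //.
have DC d0 (T0 : measurableType d0) (P0 : probability T0 R) g_ (g : T0 -> R) :
    (forall n, bounded_mfun (g_ n)) -> (forall n x, `|g_ n x| <= M) ->
    (forall x, g_ ^~ x @ \oo --> g x) ->
    (\int[P0]_x (g_ n x)%:E @[n --> \oo] --> \int[P0]_x (g x)%:E)%E.
  move=> Bg bg cg.
  have [||||//|_ _ //] := @dominated_convergence _ _ R P0 setT measurableT
    (fun n => EFin \o g_ n) (EFin \o g) (EFin \o cst M).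
  - by move=> n; apply/measurable_EFinP; case: (Bg n).
  - apply/measurable_EFinP.
    by have [] := bounded_mfun_lim Bg bg cg.
  - by apply: aeW => x _; apply: cvg_EFin; [exact: nearW|exact: cg].
  - exact: finite_measure_integrable_cst.
  - by apply: aeW => x n _ /=; rewrite lee_fin.
have c1 := DC _ _ P f_ f (fun n => let: And3 h _ _ := Ef n in h) bf cf.
have c2 := DC _ _ P' f_' f' (fun n => let: And3 _ h _ := Ef n in h) bf' cf'.
rewrite -(cvg_lim _ c1)// -(cvg_lim _ c2)//.
by congr (lim (_ @ \oo)); apply/funext => n; case: (Ef n).
Qed.

End SameExpectation.

(** * Polynomial approximation of the sign function *)

Section SignIteration.
Context {R : realType}.

(** The Newton-Schulz step for the sign function, an odd polynomial whose fixed points are -1, 0 and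
    1. *)
Definition sign_step (y : R) : R := (3 * y - y ^+ 3) / 2.

Lemma sign_stepN (y : R) : sign_step (- y) = - sign_step y.
Proof. by rewrite /sign_step; ring. Qed.

Lemma sign_step_ge (y : R) : 0 <= y <= 1 -> y <= sign_step y <= 1.
Proof.
move=> /andP[y0 y1]; rewrite /sign_step.
(* The products in [h1] and [h2] are twice [sign_step y - y] and twice [1 - sign_step y]. *)
have h1 : 0 <= y * (1 - y) * (1 + y) by rewrite !mulr_ge0//; lra.
have h2 : 0 <= (1 - y) ^+ 2 * (2 + y) by rewrite mulr_ge0 ?sqr_ge0//; lra.
by apply/andP; split; lra.
Qed.

Lemma iter_sign_stepN n (y : R) : iter n sign_step (- y) = - iter n sign_step y.
Proof. by elim: n => //= n ->; rewrite sign_stepN. Qed.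

Lemma iter_sign_step_itv n (y : R) : 0 <= y <= 1 -> 0 <= iter n sign_step y <= 1.
Proof.
move=> y01; elim: n => //= n IH.
by have := sign_step_ge IH; case/andP: IH => ? ? /andP[? ?]; apply/andP; split; lra.
Qed.

Lemma norm_iter_sign_step n (y : R) : `|y| <= 1 -> `|iter n sign_step y| <= 1.
Proof.
move=> y1; case: (lerP 0 y) => y0.
  rewrite ger0_norm in y1 => //.
  have /andP[? ?] : 0 <= iter n sign_step y <= 1.
    by apply: iter_sign_step_itv; rewrite y0.
  by rewrite ger0_norm.
rewrite ltr0_norm in y1 => //.
have /andP[? ?] : 0 <= iter n sign_step (- y) <= 1.
  by apply: iter_sign_step_itv; rewrite y1 oppr_ge0 ltW.
by rewrite -[iter _ _ y]opprK -iter_sign_stepN normrN ger0_norm.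
Qed.

(* The increasing iterates converge to a positive fixed point of sign_step. *)
Lemma cvg_iter_sign_step1 (y : R) : 0 < y <= 1 ->
  iter n sign_step y @[n --> \oo] --> (1 : R).
Proof.
move=> /andP[y0 y1].
have itv n : 0 <= iter n sign_step y <= 1.
  by apply: iter_sign_step_itv; rewrite ltW.
have nd : nondecreasing_seq (fun n => iter n sign_step y).
  by apply/nondecreasing_seqP => n /=; have /andP[] := sign_step_ge (itv n).
have cv : cvgn (fun n => iter n sign_step y).
  apply: nondecreasing_is_cvgn => //; exists 1 => _ [n _ <-].
  by have /andP[] := itv n.
set l := limn (fun n => iter n sign_step y) in cv *.
have cl : iter n sign_step y @[n --> \oo] --> l by exact: cv.
have yl : y <= l by exact: (nondecreasing_cvgn_le nd cv 0%N).
have c2 : iter n.+1 sign_step y @[n --> \oo] --> sign_step l.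
  rewrite /= /sign_step; apply: cvgMl; apply: cvgB.
    by apply: cvgM cl; exact: cvg_cst.
  by apply: (cvg_comp _ (fun x : R => x ^+ 3) cl); exact: exprn_continuous.
have c1 : iter n.+1 sign_step y @[n --> \oo] --> l.
  by rewrite (@cvg_shiftS _ (fun n => iter n sign_step y)).
have h : sign_step l = l by exact: cvg_unique c2 c1.
rewrite /sign_step in h.
(* The fixed points are 0, 1 and -1, and [0 < y <= l] leaves only 1. *)
have : l * (1 - l) * (1 + l) = 0 by lra.
move/eqP; rewrite !mulf_eq0 => /orP[/orP[]|] /eqP h0; [lra| |lra].
by have -> : 1 = l by lra.
Qed.

Lemma cvg_iter_sign_step (y : R) : `|y| <= 1 ->
  iter n sign_step y @[n --> \oo] --> Num.sg y.
Proof.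
move=> y1; have [y0|y0|->] := ltgtP y 0.
- rewrite ltr0_sg// -[y]opprK.
  under eq_cvg do rewrite iter_sign_stepN.
  apply: cvgN; apply: cvg_iter_sign_step1.
  by rewrite oppr_gt0 y0 -(ltr0_norm y0).
- by rewrite gtr0_sg//; apply: cvg_iter_sign_step1; rewrite y0 -(gtr0_norm y0).
- have -> : (fun n => iter n sign_step (0 : R)) = cst 0.
    apply/funext; elim=> //= n ->; rewrite /sign_step; ring.
  by rewrite sgr0; exact: cvg_cst.
Qed.

(* [sin (y / 2^k)] has the sign of [y] as soon as [|y| / 2^k < pi]. *)
Lemma cvg_sg_sin_scaled (y : R) :
  Num.sg (sin (y * 2^-1 ^+ k)) @[k --> \oo] --> Num.sg y.
Proof.
have c0 : y * 2^-1 ^+ k @[k --> \oo] --> 0.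
  rewrite -[X in _ --> X](mulr0 y); apply: cvgMr.
  by apply: cvg_expr; rewrite ger0_norm; lra.
apply: cvg_near_cst.
have pi0 : 0 < (pi : R) by exact: pi_gt0.
move/cvgrPdist_lt : c0 => /(_ pi pi0) [N _ hN].
exists N => // k /hN /=; rewrite sub0r normrN => h.
have k0 : 0 < (2^-1 : R) ^+ k by apply: exprn_gt0; lra.
have [y0|y0|->] := ltgtP y 0.
- rewrite ltr0_sg ?ltr0_sg// -oppr_gt0 -sinN; apply: sin_gt0_pi.
  have y2 : 0 < - (y * 2^-1 ^+ k) by rewrite -mulNr mulr_gt0// oppr_gt0.
  by rewrite y2 -ltr0_norm// -oppr_gt0.
- rewrite gtr0_sg ?gtr0_sg//; apply: sin_gt0_pi.
  by move: h; rewrite gtr0_norm ?mulr_gt0// => ->.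
- by rewrite mul0r sin0.
Qed.

End SignIteration.

(** * Cramer-Wold argument for quadrants *)

Section CramerWold.
Context {R : realType}.
Context {d : measure_display} {T : measurableType d} (P : probability T R).
Context {d' : measure_display} {T' : measurableType d'} (P' : probability T' R).
Variables (Y1 Y2 : T -> R) (Y1' Y2' : T' -> R).
Hypotheses (mY1 : measurable_fun setT Y1) (mY2 : measurable_fun setT Y2).
Hypotheses (mY1' : measurable_fun setT Y1') (mY2' : measurable_fun setT Y2').
Hypothesis same_proj : forall (s t : R) (A : set R), measurable A ->
  P ((fun w => s * Y1 w + t * Y2 w) @^-1` A) =
  P' ((fun w => s * Y1' w + t * Y2' w) @^-1` A).

Let wave (s t c : R) w := cos (s * Y1 w + t * Y2 w + c).
Let wave' (s t c : R) w := cos (s * Y1' w + t * Y2' w + c).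

Let cosM (a b : R) : cos a * cos b = 2^-1 * cos (a + b) + 2^-1 * cos (a - b).
Proof. by rewrite cosD cosB; lra. Qed.

Let measurable_cosD c : measurable_fun setT (fun x : R => cos (x + c)).
Proof.
have mcos : measurable_fun setT (@cos R).
  by apply: continuous_measurable_fun; exact: continuous_cos.
have mD : measurable_fun setT (fun x : R => x + c) by exact: measurable_funD.
exact: (measurableT_comp mcos mD).
Qed.

Lemma measurable_lincomb {d0 : measure_display} {T0 : measurableType d0}
    (Z1 Z2 : T0 -> R) (s t : R) : measurable_fun setT Z1 ->
    measurable_fun setT Z2 -> measurable_fun setT (fun w => s * Z1 w + t * Z2 w).
Proof. by move=> m1 m2; apply: measurable_funD; exact: measurable_funM. Qed.

(** A wave depends on the pair only through one projection, so both integrals are that of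
    [cos (x + c)] against the common law of this projection. *)
Lemma same_expectation_wave s t c : same_expectation P P' (wave s t c) (wave' s t c).
Proof.
have m1 : measurable_fun setT (fun w => s * Y1 w + t * Y2 w).
  exact: measurable_lincomb.
have m2 : measurable_fun setT (fun w => s * Y1' w + t * Y2' w).
  exact: measurable_lincomb.
have b1 : bounded_mfun (wave s t c).
  split; last by exists 1 => x; exact: cos_max.
  exact: (measurableT_comp (measurable_cosD c) m1).
have b2 : bounded_mfun (wave' s t c).
  split; last by exists 1 => x; exact: cos_max.
  exact: (measurableT_comp (measurable_cosD c) m2).
split=> //.
have mE : measurable_fun setT (EFin \o (fun x : R => cos (x + c))).
  by apply/measurable_EFinP.
have := @integral_pushforward _ _ _ _ _ _ m1 P setT _ mE (bounded_mfun_integrable P b1) measurableT.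
have := @integral_pushforward _ _ _ _ _ _ m2 P' setT _ mE (bounded_mfun_integrable P' b2) measurableT.
rewrite !preimage_setT => <- <-.
by apply: eq_measure_integral => A mA _; exact: same_proj.
Qed.

(** Testing against all waves, not only against 1, makes the relation stable under multiplication by
    a wave; the free phase [c] makes cosines cover sines too. *)
Definition wave_multiplier f f' := forall s t c,
  same_expectation P P' (fun w => f w * wave s t c w) (fun w => f' w * wave' s t c w).

Lemma wave_multiplier_same f f' : wave_multiplier f f' ->
  same_expectation P P' f f'.
Proof.
move=> /(_ 0 0 0); rewrite /wave /wave'; congr same_expectation.
- by apply/funext => w; rewrite !mul0r !addr0 cos0 mulr1.
- by apply/funext => w; rewrite !mul0r !addr0 cos0 mulr1.
Qed.

Lemma wave_multiplierD f f' g g' : wave_multiplier f f' -> wave_multiplier g g' ->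
  wave_multiplier (fun w => f w + g w) (fun w => f' w + g' w).
Proof.
move=> hf hg s t c; have := same_expectationD (hf s t c) (hg s t c).
by congr same_expectation; apply/funext => w; rewrite mulrDl.
Qed.

(** Product-to-sum formula: a product of two waves is half the sum of two waves, whose frequencies
    and phases are the sums and the differences. *)
Lemma wave_multiplierM s t c f f' : wave_multiplier f f' ->
  wave_multiplier (fun w => wave s t c w * f w) (fun w => wave' s t c w * f' w).
Proof.
move=> hf s' t' c'.
have := same_expectationD
  (same_expectationZ 2^-1 (hf (s + s') (t + t') (c + c')))
  (same_expectationZ 2^-1 (hf (s - s') (t - t') (c - c'))).
congr same_expectation; apply/funext => w; rewrite /wave /wave' [RHS]mulrAC cosM
  [RHS]mulrC [RHS]mulrDr; congr (_ + _); rewrite mulrCA;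
  congr (_ * (_ * cos _)); ring.
Qed.

(* Multipliers of the wave multipliers: an algebra containing the waves and
   closed under bounded pointwise limits, hence containing the indicators of
   half planes. *)
Definition cw_class (f : T -> R) (f' : T' -> R) :=
  [/\ bounded_mfun f, bounded_mfun f' & forall g g', wave_multiplier g g' ->
    wave_multiplier (fun w => f w * g w) (fun w => f' w * g' w)].

Lemma cw_class_cst k : cw_class (fun=> k) (fun=> k).
Proof.
split; [exact: bounded_mfun_cst..|] => g g' hg s t c.
by have := same_expectationZ k (hg s t c); congr same_expectation;
  apply/funext => w; rewrite mulrA.
Qed.

Lemma cw_class_wave s t c : cw_class (wave s t c) (wave' s t c).
Proof.
have [b1 b2 _] := same_expectation_wave s t c.
by split=> // g g' hg; exact: wave_multiplierM.
Qed.

Lemma cw_classD f f' g g' : cw_class f f' -> cw_class g g' ->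
  cw_class (fun w => f w + g w) (fun w => f' w + g' w).
Proof.
move=> [bf bf' hf] [bg bg' hg]; split; [exact: bounded_mfunD..|] => h h' hh.
have := wave_multiplierD (hf _ _ hh) (hg _ _ hh).
by congr wave_multiplier; apply/funext => w; rewrite mulrDl.
Qed.

(** Multiplying by a product is multiplying twice; this is what the definition by multipliers is
    made for. *)
Lemma cw_classM f f' g g' : cw_class f f' -> cw_class g g' ->
  cw_class (fun w => f w * g w) (fun w => f' w * g' w).
Proof.
move=> [bf bf' hf] [bg bg' hg]; split; [exact: bounded_mfunM..|] => h h' hh.
have := hf _ _ (hg _ _ hh).
by congr wave_multiplier; apply/funext => w; rewrite mulrA.
Qed.

Lemma cw_class_lim (f_ : nat -> T -> R) (f_' : nat -> T' -> R) f f' M :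
  (forall n, cw_class (f_ n) (f_' n)) ->
  (forall n x, `|f_ n x| <= M) -> (forall n x, `|f_' n x| <= M) ->
  (forall x, f_ ^~ x @ \oo --> f x) -> (forall x, f_' ^~ x @ \oo --> f' x) ->
  cw_class f f'.
Proof.
move=> Cf bf bf' cf cf'; split.
- by apply: bounded_mfun_lim bf cf => n; case: (Cf n).
- by apply: bounded_mfun_lim bf' cf' => n; case: (Cf n).
move=> g g' hg s t c.
(* [B] and [B'] bound the products of [g] and [g'] with the fixed wave; times [M] they dominate the
   whole sequence. *)
have [[_ [B gB]] [_ [B' gB']] _] := hg s t c.
have Bp (a b e : R) x y : `|a| <= M -> `|x * y| <= b -> b <= e -> `|a * x * y| <= M * e.
  by move=> h1 h2 h3; rewrite -mulrA normrM ler_pM// (le_trans h2).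
apply: (@same_expectation_lim _ _ _ P _ _ P'
  (fun n w => f_ n w * g w * wave s t c w)
  (fun n w => f_' n w * g' w * wave' s t c w) _ _ (M * Num.max B B')).
- by move=> n; have [_ _ h] := Cf n; exact: h.
- by move=> n x; apply: Bp (gB x) _; rewrite ?le_max ?lexx.
- by move=> n x; apply: Bp (gB' x) _; rewrite ?le_max ?lexx ?orbT.
- by move=> x; apply: cvgM; [apply: cvgM => //|]; exact: cvg_cst.
- by move=> x; apply: cvgM; [apply: cvgM => //|]; exact: cvg_cst.
Qed.

(** The constant 1 is a wave multiplier, since waves have equal expectations; acting on it by [f]
    makes [f] itself a wave multiplier, which is then tested on the constant wave. *)
Lemma cw_class_same f f' : cw_class f f' -> same_expectation P P' f f'.
Proof.
move=> [_ _ /(_ (fun=> 1) (fun=> 1))] h.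
apply: wave_multiplier_same.
have : wave_multiplier (fun=> 1) (fun=> 1).
  move=> s t c; have := same_expectation_wave s t c.
  by congr same_expectation; apply/funext => w; rewrite mul1r.
by move/h; congr wave_multiplier; apply/funext => w; rewrite mulr1.
Qed.

Lemma cw_class_sg f f' : (forall x, `|f x| <= 1) -> (forall x, `|f' x| <= 1) ->
  cw_class f f' -> cw_class (fun w => Num.sg (f w)) (fun w => Num.sg (f' w)).
Proof.
move=> f1 f1' hf.
apply: (@cw_class_lim (fun n w => iter n sign_step (f w))
                      (fun n w => iter n sign_step (f' w)) _ _ 1).
- elim=> [|n IH] //=.
  have := cw_classM (cw_class_cst 2^-1) (cw_classD (cw_classM (cw_class_cst 3) IH)
    (cw_classM (cw_class_cst (-1)) (cw_classM IH (cw_classM IH IH)))).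
  by congr cw_class; apply/funext => w; rewrite /sign_step; ring.
- by move=> n x; exact: norm_iter_sign_step.
- by move=> n x; exact: norm_iter_sign_step.
- by move=> x; exact: cvg_iter_sign_step.
- by move=> x; exact: cvg_iter_sign_step.
Qed.

(** The projection is unbounded, so its sign is reached through the sines of its dyadic rescalings,
    each of which is a wave with phase shifted by [- pi / 2]. *)
Lemma cw_class_sg_lincomb s t c :
  cw_class (fun w => Num.sg (s * Y1 w + t * Y2 w + c))
           (fun w => Num.sg (s * Y1' w + t * Y2' w + c)).
Proof.
have nsg (x : R) : `|Num.sg x| <= 1 by rewrite normr_sg; case: eqP.
apply: (@cw_class_lim (fun k w => Num.sg (sin ((s * Y1 w + t * Y2 w + c) * 2^-1 ^+ k)))
  (fun k w => Num.sg (sin ((s * Y1' w + t * Y2' w + c) * 2^-1 ^+ k))) _ _ 1) => //.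
- move=> k; apply: cw_class_sg => [x|x|]; [exact: sin_max..|].
  have := cw_class_wave (s * 2^-1 ^+ k) (t * 2^-1 ^+ k) (c * 2^-1 ^+ k - pi / 2).
  have sinE (x : R) : sin x = cos (x - pi / 2).
    by rewrite -sinDpihalf subrK.
  by congr cw_class; apply/funext => w; rewrite sinE; congr cos; ring.
- by move=> x; exact: cvg_sg_sin_scaled.
- by move=> x; exact: cvg_sg_sin_scaled.
Qed.

(** A quadratic polynomial in the sign, equal to 1, 1, 0 at the signs 1, 0, -1. *)
Let ge0_sg (x : R) : (0 <= x)%R%:R = 1 + 2^-1 * (Num.sg x + - 1 * (Num.sg x * Num.sg x)).
Proof.
have [x0|x0|->] := ltgtP x 0; first by rewrite ltr0_sg//=; lra.
  by rewrite gtr0_sg//=; lra.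
by rewrite sgr0/=; lra.
Qed.

Lemma cw_class_halfplane s t c :
  cw_class (fun w => (0 <= s * Y1 w + t * Y2 w + c)%R%:R)
           (fun w => (0 <= s * Y1' w + t * Y2' w + c)%R%:R).
Proof.
have h := cw_class_sg_lincomb s t c.
have := cw_classD (cw_class_cst 1) (cw_classM (cw_class_cst 2^-1)
  (cw_classD h (cw_classM (cw_class_cst (-1)) (cw_classM h h)))).
by congr cw_class; apply/funext => w; rewrite ge0_sg.
Qed.

(** The indicator of the quadrant is a product of two half-plane indicators, and [cw_class] is
    closed under products. *)
Theorem cramer_wold_quadrant :
  P [set w | 0 <= Y1 w /\ 0 <= Y2 w] = P' [set w | 0 <= Y1' w /\ 0 <= Y2' w].
Proof.
have [_ _] := cw_class_same (cw_classM (cw_class_halfplane 1 0 0)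
                                       (cw_class_halfplane 0 1 0)).
have mq d0 (T0 : measurableType d0) (Z1 Z2 : T0 -> R) :
    measurable_fun setT Z1 -> measurable_fun setT Z2 ->
    measurable [set w | 0 <= Z1 w /\ 0 <= Z2 w].
  move=> m1 m2; rewrite -[X in measurable X]setTI.
  have -> : [set w | 0 <= Z1 w /\ 0 <= Z2 w] =
     (Z1 @^-1` `[0, +oo[) `&` (Z2 @^-1` `[0, +oo[).
    by apply/seteqP; split => w /=; rewrite !in_itv/= !andbT.
  by rewrite setIIr; apply: measurableI; [exact: m1|exact: m2].
have iq d0 (T0 : measurableType d0) (P0 : probability T0 R) (Z1 Z2 : T0 -> R) :
    measurable_fun setT Z1 -> measurable_fun setT Z2 ->
    (\int[P0]_x ((0 <= 1 * Z1 x + 0 * Z2 x + 0)%R%:R *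
      (0 <= 0 * Z1 x + 1 * Z2 x + 0)%R%:R)%:E)%E =
    P0 [set w | 0 <= Z1 w /\ 0 <= Z2 w].
  move=> m1 m2.
  transitivity (\int[P0]_x (\1_([set w | 0 <= Z1 w /\ 0 <= Z2 w]%R) x)%:E)%E.
    apply: eq_integral => w _; congr EFin.
    rewrite !mul0r !mul1r !addr0 add0r -natrM mulnb indicE; congr (_ %:R).
    congr nat_of_bool; apply/idP/idP; first by move=> /andP[? ?]; rewrite inE.
    by rewrite inE /= => -[-> ->].
  by rewrite integral_indic ?setIT//; exact: mq.
by rewrite !iq.
Qed.

End CramerWold.

(** * Affine change of variables for the Lebesgue measure *)

Section AffineChangeOfVariables.
Context {R : realType}.
Local Notation leb := (@lebesgue_measure R).

Definition affine_map (b c : R) (x : measurableTypeR R) : measurableTypeR R :=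
  b * x + c.

Lemma measurable_affine_map b c : measurable_fun setT (affine_map b c).
Proof. by apply: measurable_funD => //; exact: measurable_funM. Qed.

(** By uniqueness of the Lebesgue measure it suffices to compare both sides on the intervals []x,
    y]]. *)
Lemma lebesgue_measure_affine (b c : R) (A : set R) : b != 0 -> measurable A ->
  leb A = (`|b|%:E * leb (affine_map b c @^-1` A))%E.
Proof.
move=> b0 mA.
apply: (@lebesgue_measure_unique R (mscale `|b|%:nng (pushforward leb (affine_map b c)))) => //.
  exact: measurable_affine_map.
move=> m _ [[x y]] _ <-.
change (leb [set` `]x, y]] = (`|b|%:E * leb (affine_map b c @^-1` [set` `]x, y]]))%E).
have [bn|bp|b00] := ltgtP b 0; last by rewrite b00 eqxx in b0.
(* A negative [b] swaps the endpoints, so the preimage is closed on the left and open on the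
   right. *)
- have -> : affine_map b c @^-1` [set` `]x, y]] = [set` `[(y - c) / b, (x - c) / b[].
    apply/seteqP; split => z /=; rewrite !in_itv/= /affine_map.
      by rewrite ler_ndivrMr ?ltr_ndivlMr// => /andP[? ?]; apply/andP; split; lra.
    by rewrite ler_ndivrMr ?ltr_ndivlMr// => /andP[? ?]; apply/andP; split; lra.
  rewrite !lebesgue_measure_itv/= !lte_fin ltr_nM2r ?invr_lt0// ltrD2r.
  case: ifP => xy; last by rewrite mule0.
  by rewrite -!EFinD -EFinM ltr0_norm//; congr EFin; field.
- have -> : affine_map b c @^-1` [set` `]x, y]] = [set` `](x - c) / b, (y - c) / b]].
    apply/seteqP; split => z /=; rewrite !in_itv/= /affine_map.
      by rewrite ler_pdivlMr ?ltr_pdivrMr// => /andP[? ?]; apply/andP; split; lra.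
    by rewrite ler_pdivlMr ?ltr_pdivrMr// => /andP[? ?]; apply/andP; split; lra.
  rewrite !lebesgue_measure_itv/= !lte_fin ltr_pM2r ?invr_gt0// ltrD2r.
  case: ifP => xy; last by rewrite mule0.
  by rewrite -!EFinD -EFinM gtr0_norm//; congr EFin; field.
Qed.

Lemma ge0_integral_affine (b c : R) (f : R -> \bar R) : b != 0 ->
  measurable_fun setT f -> (forall x, 0 <= f x)%E ->
  (\int[leb]_x f x = `|b|%:E * \int[leb]_x f (affine_map b c x))%E.
Proof.
move=> b0 mf f0.
pose push : {measure set (measurableTypeR R) -> \bar R} :=
  pushforward leb (affine_map b c).
transitivity (\int[mscale (`|b|%:nng)%R (push (measurable_affine_map b c))]_x f x)%E.
  apply: eq_measure_integral => A mA _; exact: lebesgue_measure_affine.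
rewrite ge0_integral_mscale//=; congr (_ * _)%E.
by rewrite ge0_integral_pushforward//; exact: measurable_affine_map.
Qed.

End AffineChangeOfVariables.

(** * One-dimensional normal laws *)

Section NormalLaw.
Context {R : realType}.
Local Notation leb := (@lebesgue_measure R).

Lemma normal_probE (m s : R) (A : set R) : measurable A ->
  normal_prob m s A = (\int[leb]_x ((\1_A x)%:E * (normal_pdf m s x)%:E))%E.
Proof.
move=> mA; rewrite /normal_prob integral_mkcond; apply: eq_integral => x _.
by rewrite patchE indicE; case: ifP => xA; rewrite ?mul1e ?mul0e.
Qed.

(** The Radon-Nikodym derivative of the law agrees almost everywhere with [normal_pdf], both having
    the same integral over every measurable set. *)
Lemma ge0_integral_normal_prob (m s : R) (f : R -> \bar R) :
  measurable_fun setT f -> (forall x, 0 <= f x)%E ->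
  (\int[normal_prob m s]_x f x = \int[leb]_x (f x * (normal_pdf m s x)%:E))%E.
Proof.
move=> mf f0.
have dom := normal_prob_dominates m s.
rewrite -(Radon_Nikodym_SigmaFinite.change_of_variables dom)//.
have mpdf : measurable_fun setT (fun x => (normal_pdf m s x)%:E).
  by apply/measurable_EFinP; exact: measurable_normal_pdf.
have iRN := Radon_Nikodym_SigmaFinite.f_integrable dom.
apply: ae_eq_integral => //.
- by apply: emeasurable_funM => //; exact: measurable_int iRN.
- exact: emeasurable_funM.
- apply: ae_eqe_mul2l; apply: integral_ae_eq => // E _ mE.
  by rewrite -Radon_Nikodym_SigmaFinite.f_integral.
Qed.

Lemma normal_prob_gt0 (m s x y : R) : s != 0 -> x < y ->
  (0 < normal_prob m s `]x, y[)%E.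
Proof.
(* [K] dominates [(z - m) ^+ 2] for every [z] between [x] and [y], so [e] is a positive lower bound
   of the density on the interval. *)
move=> s0 xy; set K := (x - m) ^+ 2 + (y - m) ^+ 2.
set e := normal_peak s * expR (- K / (s ^+ 2 *+ 2)).
have e0 : 0 < e by rewrite mulr_gt0 ?normal_peak_gt0 ?expR_gt0.
apply: (@lt_le_trans _ _ (\int[leb]_(z in `]x, y[) (cst e%:E) z)%E).
  rewrite integral_cst//= lebesgue_measure_itv/= lte_fin xy -EFinD -EFinM lte_fin.
  by rewrite mulr_gt0// subr_gt0.
rewrite /normal_prob; apply: ge0_le_integral => //.
- by move=> z _; rewrite lee_fin ltW.
- by apply/measurable_EFinP/measurable_funTS; exact: measurable_normal_pdf.
- move=> z /=; rewrite in_itv/= => /andP[xz zy].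
  rewrite lee_fin normal_pdfE// ler_pM2l ?normal_peak_gt0// ler_expR !mulNr lerN2.
  rewrite ler_pM2r; first by rewrite /K; have [mz|zm] := lerP m z;
    [have : 0 <= (y - z) * (y + z - m *+ 2) by apply: mulr_ge0; lra
    |have : 0 <= (z - x) * (m *+ 2 - x - z) by apply: mulr_ge0; lra];
    have := sqr_ge0 (x - m); have := sqr_ge0 (y - m); lra.
  by rewrite invr_gt0 pmulrn_lgt0// exprn_even_gt0.
Qed.

Lemma normal_prob_affine (b c : R) (A : set R) : b != 0 -> measurable A ->
  normal_prob 0 1 (affine_map b c @^-1` A) = normal_prob c `|b| A.
Proof.
move=> b0 mA.
have nb0 : `|b| != 0 by rewrite normr_eq0.
have mpre : measurable (affine_map b c @^-1` A).
  by rewrite -[X in measurable X]setTI; exact: measurable_affine_map.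
have mpdf m s : measurable_fun setT (fun x : R => (normal_pdf m s x)%:E).
  by apply/measurable_EFinP; exact: measurable_normal_pdf.
have mind (B : set R) : measurable B -> measurable_fun setT (fun x : R => (\1_B x : R)%:E).
  by move=> mB; apply/measurable_EFinP; exact: measurable_indic.
rewrite (normal_probE _ _ mpre) (normal_probE _ _ mA).
rewrite [RHS](ge0_integral_affine c b0); last 2 first.
- by apply: emeasurable_funM => //; exact: mind.
- by move=> x; rewrite mule_ge0// lee_fin normal_pdf_ge0.
rewrite -ge0_integralZl//; last 2 first.
- apply: emeasurable_funM; apply/measurable_EFinP.
    apply: (measurableT_comp _ (measurable_affine_map b c)).
    exact: measurable_indic.
  apply: (measurableT_comp _ (measurable_affine_map b c)).
  exact: measurable_normal_pdf.
- by move=> x _; rewrite mule_ge0// lee_fin normal_pdf_ge0.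
apply: eq_integral => x _; rewrite muleCA; congr (_ * _)%E.
rewrite -EFinM; congr EFin; rewrite !normal_pdfE ?oner_eq0// mulrA /normal_fun.
congr (_ * expR _); last first.
  by rewrite /affine_map addrK subr0 real_normK ?num_real//; field.
rewrite /normal_peak real_normK ?num_real// expr1n mul1r.
rewrite -mulrnAr sqrtrM ?sqr_ge0// sqrtr_sqr invfM mulrA mulfV// mul1r.
by [].
Qed.

End NormalLaw.

(** * Linear combinations of a standard Gaussian pair *)

Section GaussPlane.
Context {R : realType}.
Local Notation leb := (@lebesgue_measure R).

Definition gauss_plane : probability (measurableTypeR R * measurableTypeR R)%type R :=
  (normal_prob (0 : R) 1 \x normal_prob (0 : R) 1)%E.

Lemma normal_peakE (s : R) : normal_peak s = `|s|^-1 * (Num.sqrt (pi *+ 2))^-1.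
Proof. by rewrite /normal_peak -mulrnAr sqrtrM ?sqr_ge0// sqrtr_sqr invfM. Qed.

(** Reduces joint measurability of the density in its mean and its argument to measurability in one
    variable. *)
Lemma normal_pdf_center (m s x : R) : s != 0 ->
  normal_pdf m s x = normal_pdf 0 s (x - m).
Proof. by move=> s0; rewrite !normal_pdfE// /normal_fun subr0. Qed.

(* Completing the square: the joint density of a pair of Gaussians, factored as
   (marginal) * (conditional) in the two possible orders. *)
Lemma normal_pdf_swap (a b c x t r : R) : b != 0 -> 0 < r ->
  r ^+ 2 = a ^+ 2 + b ^+ 2 ->
  normal_pdf (a * x + c) `|b| t * normal_pdf 0 1 x =
  normal_pdf c r t * normal_pdf (a * (t - c) / r ^+ 2) (`|b| / r) x.
Proof.
move=> b0 r0 rE.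
have nb0 : `|b| != 0 by rewrite normr_eq0.
have rn0 : r != 0 by rewrite gt_eqF.
rewrite !normal_pdfE ?oner_eq0 ?mulf_neq0 ?invr_eq0// !normal_peakE.
rewrite (mulrACA _ (normal_fun _ _ _)) [RHS]mulrACA; congr (_ * _).
  rewrite normr_id normr1 (gtr0_norm (x := `|b| / r)) ?divr_gt0 ?normr_gt0//.
  by rewrite (gtr0_norm r0); field; rewrite rn0 nb0 sqrtr_eq0 -ltNge pmulrn_lgt0 ?pi_gt0.
rewrite /normal_fun -!expRD; congr expR.
rewrite expr_div_n real_normK ?num_real// rE.
have s0 : a ^+ 2 + b ^+ 2 != 0 by rewrite -rE expf_neq0.
by field; rewrite b0 s0.
Qed.

Let mlin (a b c : R) : measurable_fun setT
  (fun w : measurableTypeR R * measurableTypeR R => a * w.1 + b * w.2 + c).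
Proof.
by apply: measurable_funD => //; apply: measurable_funD => //; exact: measurable_funM.
Qed.

Lemma gauss_plane_lincomb_nondeg (a b c : R) (A : set R) : b != 0 -> measurable A ->
  gauss_plane ((fun w => a * w.1 + b * w.2 + c) @^-1` A) =
  normal_prob c (Num.sqrt (a ^+ 2 + b ^+ 2)) A.
Proof.
move=> b0 mA; set S := _ @^-1` A; set r := Num.sqrt _.
have mS : measurable S by rewrite -[S]setTI; exact: mlin.
have nb0 : `|b| != 0 by rewrite normr_eq0.
have s0 : 0 < a ^+ 2 + b ^+ 2.
  by rewrite ltr_wpDl ?sqr_ge0// exprn_even_gt0.
have r0 : 0 < r by rewrite sqrtr_gt0.
have rE : r ^+ 2 = a ^+ 2 + b ^+ 2 by rewrite sqr_sqrtr// ltW.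
have secE x : xsection S x = affine_map b (a * x + c) @^-1` A.
  by apply/seteqP; split => y; rewrite /xsection/= inE /S /affine_map/= addrAC addrC addrA
    (addrC (b * y)) -addrA (addrC (b * y)).
pose k (w : measurableTypeR R * measurableTypeR R) : \bar R :=
  ((\1_A w.2)%:E * (normal_pdf (a * w.1 + c) `|b| w.2 * normal_pdf 0 1 w.1)%:E)%E.
have k0 w : (0 <= k w)%E by rewrite mule_ge0// lee_fin ?mulr_ge0 ?normal_pdf_ge0.
have mk : measurable_fun setT k.
  apply: emeasurable_funM; apply/measurable_EFinP.
    by apply: (measurableT_comp (measurable_indic _) measurable_snd).
  apply: measurable_funM.
    under eq_fun do rewrite normal_pdf_center//.
    apply: (measurableT_comp (measurable_normal_pdf 0 `|b|)).
    have := mlin (- a) 1 (- c); congr measurable_fun; apply/funext => w; ring.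
  exact: (measurableT_comp (measurable_normal_pdf 0 1) measurable_fst).
transitivity (\int[leb]_x \int[leb]_t k (x, t))%E.
  rewrite [LHS]ge0_integral_normal_prob//; last first.
    exact: (@measurable_fun_xsection _ _ _ _ R (normal_prob 0 1)).
  apply: eq_integral => x _ /=.
  rewrite secE (normal_prob_affine _ b0 mA) (normal_probE _ _ mA) muleC.
  have mt : measurable_fun setT
      (fun t => ((\1_A t)%:E * (normal_pdf (a * x + c) `|b| t)%:E)%E).
    apply: emeasurable_funM; apply/measurable_EFinP; first exact: measurable_indic.
    exact: measurable_normal_pdf.
  rewrite -ge0_integralZl => [|//|//|t _|].
  - by apply: eq_integral => t _; rewrite /k/= EFinM muleCA (muleC (normal_pdf 0 1 x)%:E).
  - by rewrite mule_ge0// lee_fin normal_pdf_ge0.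
  - by rewrite lee_fin normal_pdf_ge0.
rewrite fubini_tonelli// normal_probE//; apply: eq_integral => t _.
rewrite /k/=.
(* The density remaining in [x] is the conditional one, and it integrates to 1. *)
under eq_integral do rewrite (normal_pdf_swap _ _ _ b0 r0 rE) EFinM muleA.
rewrite ge0_integralZl//.
- by rewrite integral_normal_pdf mule1.
- by apply/measurable_EFinP; exact: measurable_normal_pdf.
- by move=> x _; rewrite lee_fin normal_pdf_ge0.
- by rewrite mule_ge0// lee_fin normal_pdf_ge0.
Qed.

(** When [b = 0] the event is a cylinder over the first axis, or the combination is constant, which
    is the Dirac branch of [gauss_law]. *)
Lemma gauss_plane_lincomb (a b c : R) (A : set R) : measurable A ->
  gauss_plane ((fun w => a * w.1 + b * w.2 + c) @^-1` A) =
  gauss_law c (a ^+ 2 + b ^+ 2) A.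
Proof.
move=> mA; rewrite /gauss_law paddr_eq0 ?sqr_ge0// !sqrf_eq0.
have [->|b0] := eqVneq b 0; last first.
  by rewrite andbF; exact: gauss_plane_lincomb_nondeg.
rewrite andbT; have [->|a0] := eqVneq a 0.
  have -> : (fun w : R * R => 0 * w.1 + 0 * w.2 + c) = cst c.
    by apply/funext => w /=; ring.
  rewrite preimage_cst diracE; case: ifP => _; [exact: probability_setT|exact: measure0].
have -> : (fun w : R * R => a * w.1 + 0 * w.2 + c) @^-1` A =
          (affine_map a c @^-1` A) `*` setT.
  by apply/seteqP; split => w /=; rewrite /affine_map mul0r addr0; [|case].
rewrite expr0n addr0 sqrtr_sqr -normal_prob_affine//.
rewrite [LHS]product_measure1E//; last first.
  by rewrite -[X in measurable X]setTI; exact: measurable_affine_map.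
by rewrite [X in (_ * X)%E]probability_setT mule1.
Qed.

End GaussPlane.

(** * Strict monotonicity of quadrant probabilities in the correlation *)

Section QuadrantProbability.
Context {R : realType}.
Local Notation plane := (measurableTypeR R * measurableTypeR R)%type.

Lemma probability_lt_subset {d : measure_display} {T : measurableType d}
    (P : probability T R) (A B D : set T) :
  measurable A -> measurable B -> measurable D ->
  A `<=` B -> D `<=` B `\` A -> (0 < P D)%E -> (P A < P B)%E.
Proof.
move=> mA mB mD AB DBA D0.
have AD : A `&` D = set0.
  by apply/seteqP; split => // x [Ax /DBA[]].
apply: (@lt_le_trans _ _ (P (A `|` D))).
  by rewrite measureU// lteDl// fin_num_measure.
apply: le_measure; rewrite ?inE//; first exact: measurableU.
by move=> x [/AB//|/DBA[]].
Qed.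

(** At abscissa [x1] the two boundary lines are at vertical distance [g]; a thin rectangle starting
    there and filling the middle third of the gap stays between them. *)
Lemma gauss_plane_strip_gt0 (a c a' c' x1 e : R) : 0 < e ->
  a * x1 + c < a' * x1 + c' ->
  exists D : set plane, [/\ measurable D, (0 < gauss_plane D)%E &
    forall w, D w -> x1 < w.1 < x1 + e /\
                     0 < a' * w.1 + c' + w.2 /\ a * w.1 + c + w.2 < 0].
Proof.
move=> e0 lt1; set g := a' * x1 + c' - (a * x1 + c).
have g0 : 0 < g by rewrite subr_gt0.
(* A width of at most [g / K] keeps the variation of either line within [g / 3]; the summand 1 makes
   [K] positive. *)
set K := 3 * (`|a| + `|a'| + 1).
have K0 : 0 < K by rewrite mulr_gt0// ltr_wpDl// addr_ge0.
set dl := Num.min e (g / K).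
have dl0 : 0 < dl by rewrite lt_min e0 divr_gt0.
have dle : dl <= e by rewrite ge_min lexx.
have dlg : dl * K <= g by rewrite -ler_pdivlMr// ge_min lexx orbT.
set y1 := - (a' * x1 + c') + g / 3; set y2 := - (a * x1 + c) - g / 3.
have y12 : y1 < y2 by rewrite /y1 /y2 /g in g0 *; lra.
exists ([set` `]x1, x1 + dl[] `*` [set` `]y1, y2[]); split.
- exact: measurableX.
- rewrite [X in (_ < X)%E]product_measure1E//.
  by rewrite mule_gt0//; apply: normal_prob_gt0; rewrite ?oner_eq0//; lra.
- move=> [x y] /=; rewrite !in_itv/= => -[/andP[h1 h2] /andP[h3 h4]].
  have na : `|a * (x - x1)| <= g / 3.
    rewrite normrM (ger0_norm (x := x - x1)); last by lra.
    have : `|a| * (x - x1) <= (`|a| + `|a'| + 1) * dl.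
      by apply: ler_pM => //; [lra| have := normr_ge0 a'; lra|lra].
    by rewrite /K in dlg; lra.
  have na' : `|a' * (x - x1)| <= g / 3.
    rewrite normrM (ger0_norm (x := x - x1)); last by lra.
    have : `|a'| * (x - x1) <= (`|a| + `|a'| + 1) * dl.
      by apply: ler_pM => //; [lra| have := normr_ge0 a; lra|lra].
    by rewrite /K in dlg; lra.
  move: na na'; rewrite !ler_norml => /andP[n1 n2] /andP[n3 n4].
  by rewrite /y1 /y2 in h3 h4; split; [apply/andP; split; lra|split; lra].
Qed.

(** After clearing denominators the squares of the two sides differ by [r' ^+ 2 - r ^+ 2], so only
    the signs of [r] and [r'] have to be distinguished. *)
Lemma slope_lt (r r' : R) : -1 < r -> r < r' -> r' < 1 ->
  r / Num.sqrt (1 - r ^+ 2) < r' / Num.sqrt (1 - r' ^+ 2).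
Proof.
move=> r1 rr r'1.
have p : 0 < 1 - r ^+ 2 by nra.
have p' : 0 < 1 - r' ^+ 2 by nra.
set s := Num.sqrt (1 - r ^+ 2); set s' := Num.sqrt (1 - r' ^+ 2).
have s0 : 0 < s by rewrite sqrtr_gt0.
have s0' : 0 < s' by rewrite sqrtr_gt0.
have sE : s ^+ 2 = 1 - r ^+ 2 by rewrite sqr_sqrtr// ltW.
have sE' : s' ^+ 2 = 1 - r' ^+ 2 by rewrite sqr_sqrtr// ltW.
rewrite ltr_pdivrMr// mulrAC ltr_pdivlMr//.
have E : (r' * s) ^+ 2 - (r * s') ^+ 2 = r' ^+ 2 - r ^+ 2.
  by rewrite !exprMn sE sE'; ring.
have [r0|r0] := lerP 0 r.
  rewrite -ltr_sqr ?nnegrE ?mulr_ge0 ?(ltW s0) ?(ltW s0')//; last by lra.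
  by rewrite -subr_gt0 E; nra.
have [r0'|r0'] := lerP 0 r'.
  apply: (@lt_le_trans _ _ 0); first by rewrite nmulr_rlt0.
  by rewrite mulr_ge0// ltW.
rewrite -ltrN2 -!mulNr -ltr_sqr ?nnegrE ?mulr_ge0 ?(ltW s0) ?(ltW s0')//; [|lra|lra].
by rewrite -subr_gt0 !mulNr !sqrrN -opprB E; nra.
Qed.

Lemma lte_of_eq_sum (x x' y y' : \bar R) : x \is a fin_num ->
  x' \is a fin_num -> y \is a fin_num -> y' \is a fin_num ->
  (x' < x -> x + y = x' + y' -> y < y')%E.
Proof.
case: x => // x _; case: x' => // x' _; case: y => // y _; case: y' => // y' _.
by rewrite -!EFinD !lte_fin => ? -[]; lra.
Qed.

(* To the right of the crossing abscissa x0 of the two boundary lines A' contains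
   A, to the left it is the opposite. Whichever side of x0 contains the boundary
   of H, one compares on that side, passing to complements if needed. *)
Lemma gauss_plane_single_crossing (A A' H : set plane) (a c a' c' h : R) :
  measurable A -> measurable A' -> measurable H ->
  gauss_plane A = gauss_plane A' -> a < a' ->
  (forall w, A w <-> 0 <= a * w.1 + c + w.2) ->
  (forall w, A' w <-> 0 <= a' * w.1 + c' + w.2) ->
  (forall w, H w <-> - h <= w.1) ->
  (gauss_plane (A `&` H) < gauss_plane (A' `&` H))%E.
Proof.
move=> mA mA' mH + slope inA inA' inH.
set x0 := (c - c') / (a' - a).
have da : 0 < a' - a by rewrite subr_gt0.
have x0E : (a' - a) * x0 = c - c' by rewrite /x0 mulrC divfK// gt_eqF.
have [hx _|hx] := lerP x0 (- h).
  (* Starting at [- h + 1] puts the strip inside [H] and strictly to the right of [x0]. *)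
  have [D [mD D0 DE]] : exists D : set plane, [/\ measurable D, (0 < gauss_plane D)%E &
    forall w, D w -> - h + 1 < w.1 < - h + 1 + 1 /\
                     0 < a' * w.1 + c' + w.2 /\ a * w.1 + c + w.2 < 0].
    by apply: gauss_plane_strip_gt0 => //; nra.
  apply: (probability_lt_subset _ _ mD _ _ D0); try exact: measurableI.
    move=> w [/inA Aw /inH Hw]; split; last exact/inH.
    apply/inA'; have : 0 <= (a' - a) * (w.1 - x0) by apply: mulr_ge0; lra.
    lra.
  move=> w /DE[/andP[w1 w2] [w3 w4]]; split.
    by split; [apply/inA'; lra|apply/inH; lra].
  by move=> [/inA]; lra.
(* This strip lies between [- h - 1] and [- h], outside [H] and to the left of [x0]. *)
have [D [mD D0 DE]] : exists D : set plane, [/\ measurable D, (0 < gauss_plane D)%E &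
    forall w, D w -> - h - 1 < w.1 < - h - 1 + 1 /\
                     0 < a * w.1 + c + w.2 /\ a' * w.1 + c' + w.2 < 0].
  by apply: gauss_plane_strip_gt0 => //; nra.
have : (gauss_plane (A' `\` H) < gauss_plane (A `\` H))%E.
  apply: (probability_lt_subset _ _ mD _ _ D0); try exact: measurableD.
    move=> w [/inA' Aw nH]; split => //; apply/inA.
    have wh : w.1 < - h by rewrite ltNge; apply/negP => ?; apply: nH; exact/inH.
    have : 0 <= (a' - a) * (x0 - w.1) by apply: mulr_ge0; lra.
    lra.
  move=> w /DE[/andP[w1 w2] [w3 w4]]; split.
    by split; [apply/inA; lra|move/inH; lra].
  by move=> [/inA']; lra.
have split_ (B : set plane) : measurable B ->
    gauss_plane B = (gauss_plane (B `\` H) + gauss_plane (B `&` H))%E.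
  by move=> mB; exact: measureDI.
have fin (B : set plane) : measurable B -> gauss_plane B \is a fin_num.
  exact: fin_num_measure.
rewrite (split_ _ mA) (split_ _ mA').
exact: (lte_of_eq_sum (fin _ (measurableD mA mH)) (fin _ (measurableD mA' mH))
  (fin _ (measurableI _ _ mA mH)) (fin _ (measurableI _ _ mA' mH))).
Qed.

(** The second form, without [k], is the Cholesky expression of a standard normal variable of
    correlation [r] with [w.1]: this is the upper orthant probability of a standardized pair at
    thresholds [- h] and [- k]. *)
Definition quadrant_prob (r h k : R) : \bar R :=
  gauss_plane [set w : plane | 0 <= w.1 + h /\
                               0 <= r * w.1 + Num.sqrt (1 - r ^+ 2) * w.2 + k].

Let halfplane (a b c : R) : set plane := [set w | 0 <= a * w.1 + b * w.2 + c].

Let mhalfplane a b c : measurable (halfplane a b c).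
Proof.
have -> : halfplane a b c =
    (fun w : plane => a * w.1 + b * w.2 + c) @^-1` [set` `[0, +oo[].
  by apply/seteqP; split => w /=; rewrite in_itv/= andbT.
have mf : measurable_fun setT (fun w : plane => a * w.1 + b * w.2 + c).
  by apply: measurable_funD => //; apply: measurable_funD => //; exact: measurable_funM.
by rewrite -[X in measurable X]setTI; exact: mf.
Qed.

(** Strict bivariate Slepian inequality. The normal vector of the second half plane has length 1, so
    its mass does not depend on the correlation, and the single crossing of the two boundaries
    decides. *)
Lemma quadrant_prob_lt (r r' h k : R) : -1 < r -> r < r' -> r' < 1 ->
  (quadrant_prob r h k < quadrant_prob r' h k)%E.
Proof.
move=> r1 rr r'1.
have := slope_lt r1 rr r'1; rewrite /quadrant_prob.
have p : 0 < 1 - r ^+ 2 by nra.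
have p' : 0 < 1 - r' ^+ 2 by nra.
set s := Num.sqrt (1 - r ^+ 2); set s' := Num.sqrt (1 - r' ^+ 2) => slope.
have s0 : 0 < s by rewrite sqrtr_gt0.
have s0' : 0 < s' by rewrite sqrtr_gt0.
set H := halfplane 1 0 h; set A := halfplane r s k; set A' := halfplane r' s' k.
have [mH mA mA'] : [/\ measurable H, measurable A & measurable A'].
  by split; exact: mhalfplane.
have hE (a b : R) : [set w : plane | 0 <= w.1 + h /\ 0 <= a * w.1 + b * w.2 + k] =
    halfplane a b k `&` H.
  apply/seteqP; split => w; rewrite /H /halfplane /= mul1r mul0r addr0.
    by case.
  by case.
rewrite !hE -/A -/A'.
have gA (a b : R) : a ^+ 2 + b ^+ 2 = 1 ->
    gauss_plane (halfplane a b k) = gauss_law k 1 [set` `[0, +oo[].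
  move=> ab.
  have mI : measurable ([set` `[0, +oo[] : set R) by exact: measurable_itv.
  have := gauss_plane_lincomb a b k mI; rewrite ab => <-; congr (gauss_plane _).
  by apply/seteqP; split => w /=; rewrite in_itv/= andbT.
have AA' : gauss_plane A = gauss_plane A'.
  by rewrite !gA// sqr_sqrtr ?ltW//; ring.
have is0 : 0 < s^-1 by rewrite invr_gt0.
have is0' : 0 < s'^-1 by rewrite invr_gt0.
have inA w : A w <-> 0 <= r / s * w.1 + k / s + w.2.
  have -> : r / s * w.1 + k / s + w.2 = (r * w.1 + s * w.2 + k) / s.
    by field; rewrite gt_eqF.
  rewrite (pmulr_lge0 _ is0).
  exact: iff_refl.
have inA' w : A' w <-> 0 <= r' / s' * w.1 + k / s' + w.2.
  have -> : r' / s' * w.1 + k / s' + w.2 = (r' * w.1 + s' * w.2 + k) / s'.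
    by field; rewrite gt_eqF.
  rewrite (pmulr_lge0 _ is0').
  exact: iff_refl.
have inH w : H w <-> - h <= w.1.
  by rewrite /H /halfplane/= mul1r mul0r addr0; split; lra.
exact: (gauss_plane_single_crossing mA mA' mH AA' slope inA inA' inH).
Qed.

End QuadrantProbability.

(** * Quadrant probabilities of a bivariate normal pair *)

Section BivariateNormal.
Context {R : realType}.
Local Notation plane := (measurableTypeR R * measurableTypeR R)%type.

Lemma quadrant_prob_inj (r r' h k : R) : -1 < r < 1 -> -1 < r' < 1 ->
  quadrant_prob r h k = quadrant_prob r' h k -> r = r'.
Proof.
move=> /andP[r1 r2] /andP[r1' r2'] E; have [rr|rr|//] := ltgtP r r'.
  by have := quadrant_prob_lt h k r1 rr r2'; rewrite E ltxx.
by have := quadrant_prob_lt h k r1' rr r2; rewrite E ltxx.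
Qed.

Lemma correlation_itv (q1 q2 c : R) : 0 < q1 -> 0 < q2 -> c ^+ 2 < q1 * q2 ->
  -1 < c / (Num.sqrt q1 * Num.sqrt q2) < 1.
Proof.
move=> q10 q20 cq.
have s0 : 0 < Num.sqrt q1 * Num.sqrt q2 by rewrite mulr_gt0 ?sqrtr_gt0.
rewrite -ltr_norml normrM normfV (gtr0_norm s0) ltr_pdivrMr// mul1r.
by rewrite -sqrtrM ?ltW// -sqrtr_sqr ltr_sqrt// mulr_gt0.
Qed.

(** The model pair [Y1], [Y2], built on the standard plane with the same means and covariance, has
    the same projections. Cramer-Wold transfers the quadrant, and positive rescaling standardizes
    it. *)
Lemma bivariate_quadrant {d : measure_display} {T : measurableType d}
    (P : probability T R) (X1 X2 : T -> R) (m1 m2 q1 q2 c : R) :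
  measurable_fun setT X1 -> measurable_fun setT X2 ->
  (forall (s t : R) (A : set R), measurable A ->
    P ((fun w => s * X1 w + t * X2 w) @^-1` A) =
    gauss_law (s * m1 + t * m2) (s ^+ 2 * q1 + 2 * s * t * c + t ^+ 2 * q2) A) ->
  0 < q1 -> 0 < q2 -> c ^+ 2 < q1 * q2 ->
  P [set w | 0 <= X1 w /\ 0 <= X2 w] =
  quadrant_prob (c / (Num.sqrt q1 * Num.sqrt q2)) (m1 / Num.sqrt q1) (m2 / Num.sqrt q2).
Proof.
move=> mX1 mX2 law q10 q20 cq.
have /andP[r1 r2] := correlation_itv q10 q20 cq.
set s1 := Num.sqrt q1 in r1 r2 *; set s2 := Num.sqrt q2 in r1 r2 *.
have s10 : 0 < s1 by rewrite sqrtr_gt0.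
have s20 : 0 < s2 by rewrite sqrtr_gt0.
have s1E : s1 ^+ 2 = q1 by rewrite sqr_sqrtr// ltW.
have s2E : s2 ^+ 2 = q2 by rewrite sqr_sqrtr// ltW.
have cE : c = c / (s1 * s2) * (s1 * s2).
  by rewrite divfK// mulf_neq0 ?gt_eqF.
move: cE r1 r2; set r := c / (s1 * s2) => cE r1 r2.
have p : 0 <= 1 - r ^+ 2 by nra.
rewrite /quadrant_prob; set v := Num.sqrt (1 - r ^+ 2).
have vE : v ^+ 2 = 1 - r ^+ 2 by rewrite sqr_sqrtr.
(* Only [v ^+ 2] is used below, so [v] becomes an abstract number. *)
move: v vE => v vE.
pose Y1 (w : plane) : R := s1 * w.1 + m1.
pose Y2 (w : plane) : R := s2 * (r * w.1 + v * w.2) + m2.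
have mY1 : measurable_fun setT Y1.
  by apply: measurable_funD => //; exact: measurable_funM.
have mY2 : measurable_fun setT Y2.
  apply: measurable_funD => //; apply: measurable_funM => //.
  by apply: measurable_funD => //; exact: measurable_funM.
have law' (s t : R) (A : set R) (mA : measurable A) :
    P ((fun w => s * X1 w + t * X2 w) @^-1` A) =
    gauss_plane ((fun w => s * Y1 w + t * Y2 w) @^-1` A).
  rewrite (law _ _ _ mA).
  have -> : (fun w => s * Y1 w + t * Y2 w) = (fun w : plane =>
      (s * s1 + t * s2 * r) * w.1 + (t * s2 * v) * w.2 + (s * m1 + t * m2)).
    by apply/funext => w; rewrite /Y1 /Y2; ring.
  rewrite (gauss_plane_lincomb _ _ _ mA).
  have -> : (s * s1 + t * s2 * r) ^+ 2 + (t * s2 * v) ^+ 2 =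
      s ^+ 2 * q1 + 2 * s * t * c + t ^+ 2 * q2; last exact: erefl.
  by rewrite cE -s1E -s2E exprMn vE; ring.
rewrite (cramer_wold_quadrant mX1 mX2 mY1 mY2 law').
congr (gauss_plane _); apply/seteqP; split=> w /=.
  rewrite /Y1 /Y2 => -[h1 h2]; split.
    have -> : w.1 + m1 / s1 = (s1 * w.1 + m1) / s1 by field; rewrite gt_eqF.
    by rewrite divr_ge0// ltW.
  have -> : r * w.1 + v * w.2 + m2 / s2 = (s2 * (r * w.1 + v * w.2) + m2) / s2.
    by field; rewrite gt_eqF.
  by rewrite divr_ge0// ltW.
rewrite /Y1 /Y2 => -[h1 h2]; split.
  have -> : s1 * w.1 + m1 = s1 * (w.1 + m1 / s1) by field; rewrite gt_eqF.
  by rewrite mulr_ge0// ltW.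
have -> : s2 * (r * w.1 + v * w.2) + m2 = s2 * (r * w.1 + v * w.2 + m2 / s2).
  by field; rewrite gt_eqF.
by rewrite mulr_ge0// ltW.
Qed.

Lemma gauss_law_halfline (m q : R) : 0 < q ->
  gauss_law m q [set` `[0, +oo[] = normal_prob 0 1 [set` `[- (m / Num.sqrt q), +oo[].
Proof.
move=> q0; rewrite /gauss_law (gt_eqF q0).
have s0 : 0 < Num.sqrt q by rewrite sqrtr_gt0.
rewrite -[X in normal_prob m X](gtr0_norm s0) -normal_prob_affine ?gt_eqF//.
congr (normal_prob 0 1 _); apply/seteqP; split => x /=;
  rewrite !in_itv/= !andbT /affine_map.
  by move=> h; rewrite -mulNr ler_pdivrMr//; lra.
by rewrite -mulNr ler_pdivrMr//; lra.
Qed.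

Lemma normal_halfline_lt (a b : R) : a < b ->
  (normal_prob 0 1 [set` `[(- a)%R, +oo[] < normal_prob 0 1 [set` `[(- b)%R, +oo[])%E.
Proof.
move=> ab.
apply: (@probability_lt_subset _ _ _ (normal_prob 0 1) _ _ [set` `]- b, - a[]) => //.
- by move=> x /=; rewrite !in_itv/= !andbT; lra.
- move=> x /=; rewrite !in_itv/= !andbT => /andP[? ?]; split; first exact: ltW.
  by apply/negP; rewrite -ltNge.
- by apply: normal_prob_gt0; rewrite ?oner_eq0//; lra.
Qed.

Lemma normal_halfline_inj (a b : R) :
  normal_prob 0 1 [set` `[- a, +oo[] = normal_prob 0 1 [set` `[- b, +oo[] -> a = b.
Proof.
move=> E; have [ab|ab|//] := ltgtP a b.
  by have := normal_halfline_lt ab; rewrite E ltxx.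
by have := normal_halfline_lt ab; rewrite E ltxx.
Qed.

(** Makes ties between two alternatives negligible. *)
Lemma gauss_law_set1 (m q x : R) : 0 < q -> gauss_law m q [set x] = 0%E.
Proof.
by move=> q0; rewrite /gauss_law (gt_eqF q0) /normal_prob integral_set1.
Qed.

End BivariateNormal.

(** * The covariance as a Euclidean geometry *)

Section CovarianceGeometry.
Context {R : realType} {n : nat}.
Implicit Types (S : 'M[R]_n) (u v w : 'cV[R]_n) (i j k : 'I_n).

Definition bilform S u v : R := (u^T *m S *m v) 0 0.

Lemma bilformDl S u v w : bilform S (u + v) w = bilform S u w + bilform S v w.
Proof. by rewrite /bilform linearD !mulmxDl mxE. Qed.

Lemma bilformDr S u v w : bilform S w (u + v) = bilform S w u + bilform S w v.
Proof. by rewrite /bilform mulmxDr mxE. Qed.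

Lemma bilformZl S (a : R) u v : bilform S (a *: u) v = a * bilform S u v.
Proof. by rewrite /bilform linearZ -!scalemxAl mxE. Qed.

Lemma bilformZr S (a : R) u v : bilform S u (a *: v) = a * bilform S u v.
Proof. by rewrite /bilform -scalemxAr mxE. Qed.

Lemma bilformC S u v : S^T = S -> bilform S u v = bilform S v u.
Proof.
move=> symS; rewrite /bilform.
have -> : u^T *m S *m v = (v^T *m S *m u)^T.
  by rewrite !trmx_mul trmxK symS mulmxA.
by rewrite mxE.
Qed.

Lemma bilform_delta S i v : bilform S (delta_mx i 0) v = (S *m v) i 0.
Proof. by rewrite /bilform trmx_delta -mulmxA -rowE mxE. Qed.

Lemma bilform_delta2 S i j : bilform S (delta_mx i 0) (delta_mx j 0) = S i j.
Proof. by rewrite bilform_delta -colE mxE. Qed.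

(** The coefficient vector of [X_i - X_j]; the minus sign is written as a scaling so that additivity
    and homogeneity of [bilform] suffice to expand it. *)
Definition dvec i j : 'cV[R]_n := delta_mx i 0 + (-1) *: delta_mx j 0.

(* Squared distance of the utilities i and j in the Gaussian space, i.e. the
   variance of X_i - X_j. *)
Definition sqdist S i j : R := S i i + S j j - 2 * S i j.

(* The covariance of X_i - X_j and X_j - X_k, by the law of cosines. *)
Definition sqcov S i j k : R := (sqdist S i k - sqdist S i j - sqdist S j k) / 2.

Lemma symmx_entry S i j : S^T = S -> S i j = S j i.
Proof. by move=> symS; rewrite -[in LHS]symS mxE. Qed.

Lemma sqdistC S i j : S^T = S -> sqdist S i j = sqdist S j i.
Proof. by move=> symS; rewrite /sqdist (symmx_entry i j symS); ring. Qed.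

Lemma bilform_dvec S i j k (s t : R) : S^T = S ->
  bilform S (s *: dvec i j + t *: dvec j k) (s *: dvec i j + t *: dvec j k) =
  s ^+ 2 * sqdist S i j + 2 * s * t * sqcov S i j k + t ^+ 2 * sqdist S j k.
Proof.
move=> symS; rewrite /dvec !(bilformDl, bilformDr, bilformZl, bilformZr) !bilform_delta2.
rewrite (symmx_entry j i symS) (symmx_entry k i symS) (symmx_entry k j symS).
by rewrite /sqcov /sqdist; field.
Qed.

Lemma lincomb_delta i (x : 'I_n -> R) :
  \sum_(l < n) (delta_mx i 0 : 'cV[R]_n) l 0 * x l = x i.
Proof.
rewrite (bigD1 i)//= mxE !eqxx mul1r big1 ?addr0// => l li.
by rewrite mxE (negbTE li) mul0r.
Qed.

Lemma lincomb_dvec i j k (s t : R) (x : 'I_n -> R) :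
  \sum_(l < n) (s *: dvec i j + t *: dvec j k) l 0 * x l =
  s * (x i - x j) + t * (x j - x k).
Proof.
rewrite -[in x i](lincomb_delta i x) -[in x j](lincomb_delta j x).
rewrite -[in x k](lincomb_delta k x) -!sumrB !mulr_sumr -big_split/=.
by apply: eq_bigr => l _; rewrite /dvec !mxE; ring.
Qed.

(** * Consequences of the normalization *)

Section Normalized.
Variables (mu : 'cV[R]_n) (S : 'M[R]_n).
Hypotheses (n0 : (0 < n)%N) (hN : probit_normalized mu S).

Lemma probit_sym : S^T = S. Proof. by case: hN. Qed.

(** Along [e + t *: v] the form is affine in [t] and never negative, so its slope vanishes. *)
Lemma bilform_ker v : bilform S v v = 0 -> S *m v = 0.
Proof.
have [symS psd _ _ _] := hN => v0.
apply/colP => i; rewrite [RHS]mxE -bilform_delta; set e := delta_mx i 0.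
have h t : 0 <= bilform S e e + 2 * t * bilform S e v.
  have := psd (e + t *: v); rewrite -/(bilform S _ _).
  rewrite !(bilformDl, bilformDr, bilformZl, bilformZr) v0 (bilformC v e symS).
  by lra.
move: h; set a := bilform S e e; set b := bilform S e v => h.
apply/eqP; apply: contraT => b0.
(* At this [t] the affine function would take the value -1. *)
have := h (- (a + 1) / (2 * b)).
have -> : 2 * (- (a + 1) / (2 * b)) * b = - (a + 1) by field.
by lra.
Qed.

(** By the rank hypothesis the kernel is the line of constant vectors, and the only one with zero
    sum is 0. *)
Lemma bilform_gt0 v : v != 0 -> \sum_i v i 0 = 0 -> 0 < bilform S v v.
Proof.
have [symS psd _ S1 [_ rkS]] := hN => v0 sv.
rewrite lt_neqAle psd andbT eq_sym; apply: contra v0 => /eqP/bilform_ker Sv.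
have rker : \rank (kermx S) = 1%N.
  by rewrite mxrank_ker rkS -{1}(prednK n0) subSnn.
have ker1 w : S *m w = 0 -> (w^T <= kermx S)%MS.
  move=> Sw; apply/sub_kermxP; apply: trmx_inj.
  by rewrite trmx_mul trmxK symS Sw trmx0.
set one : 'cV[R]_n := const_mx 1 in S1.
have one0 : one^T != 0.
  apply/eqP => /(congr1 (fun M : 'rV[R]_n => M 0 (Ordinal n0))).
  by rewrite !mxE => /eqP; rewrite oner_eq0.
have : (v^T <= one^T)%MS.
  apply: submx_trans (ker1 _ Sv) _.
  by rewrite -(geq_leqif (mxrank_leqif_sup (ker1 _ S1))) rker rank_rV one0.
case/sub_rVP => a va.
have vE i : v i 0 = a.
  by have := congr1 (fun M : 'rV[R]_n => M 0 i) va; rewrite !mxE mulr1.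
move: sv; under eq_bigr do rewrite vE.
rewrite sumr_const card_ord -mulr_natr => /eqP; rewrite mulf_eq0 pnatr_eq0.
rewrite [(n == 0)%N]gtn_eqF// orbF => /eqP a0.
by apply/eqP/colP => i; rewrite vE a0 mxE.
Qed.

Lemma sum_dvec i j k (s t : R) :
  \sum_l (s *: dvec i j + t *: dvec j k) l 0 = 0.
Proof.
under eq_bigr => l _ do rewrite -[_ l 0]mulr1.
by rewrite (lincomb_dvec i j k s t (fun=> 1)); ring.
Qed.

Lemma sqdist_gt0 i j : i != j -> 0 < sqdist S i j.
Proof.
move=> ij.
(* The term with coefficient 0 only gives the vector the shape required by [bilform_dvec]. *)
have -> : sqdist S i j = bilform S (1 *: dvec i j + 0 *: dvec j j) (1 *: dvec i j + 0 *: dvec j j).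
  by rewrite (bilform_dvec _ _ _ _ _ probit_sym); ring.
apply: bilform_gt0; last exact: sum_dvec.
apply/eqP => /(congr1 (fun M : 'cV[R]_n => M i 0)); rewrite !mxE !eqxx (negbTE ij)/=.
by move=> /eqP; rewrite !(mulr0, mul0r, addr0, mul1r) oner_eq0.
Qed.

(** Strict Cauchy-Schwarz: the form is positive at [q *: dvec i j - c *: dvec j k], whose entry at
    [i] is [q], and its value there is [q] times the difference of the two sides. *)
Lemma sqcov_lt i j k : i != j -> j != k -> i != k ->
  sqcov S i j k ^+ 2 < sqdist S i j * sqdist S j k.
Proof.
move=> ij jk ik; have q0 := sqdist_gt0 jk.
set q := sqdist S j k in q0 *; set c := sqcov S i j k.
have : 0 < bilform S (q *: dvec i j + (- c) *: dvec j k) (q *: dvec i j + (- c) *: dvec j k).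
  apply: bilform_gt0; last exact: sum_dvec.
  apply/eqP => /(congr1 (fun M : 'cV[R]_n => M i 0)).
  rewrite !mxE !eqxx (negbTE ij) (negbTE ik)/= => /eqP.
  by rewrite !(mulr0, addr0, mulr1) gt_eqF.
rewrite (bilform_dvec _ _ _ _ _ probit_sym) -/q -/c => h.
have : 0 < q * (sqdist S i j * q - c ^+ 2) by lra.
by rewrite pmulr_rgt0// subr_gt0.
Qed.

(** The row sums of [S] vanish and its trace is [n]; thus squared distances determine the
    variances. *)
Lemma sum_sqdist i : \sum_j sqdist S i j = n%:R * S i i + n%:R.
Proof.
have [_ _ _ S1 [trS _]] := hN.
have rs : \sum_j S i j = 0.
  have := congr1 (fun M : 'cV[R]_n => M i 0) S1; rewrite !mxE => h.
  by rewrite -[RHS]h; apply: eq_bigr => j _; rewrite mxE mulr1.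
rewrite /sqdist sumrB big_split/= sumr_const card_ord -mulr_sumr rs mulr0 subr0.
by rewrite mulr_natl -[\sum_j S j j]/(\tr S) trS.
Qed.

(** The trace condition expressed in distances, used to fix the scale of the configuration. *)
Lemma sum_sum_sqdist : \sum_i \sum_j sqdist S i j = 2 * n%:R ^+ 2.
Proof.
have [_ _ _ _ [trS _]] := hN.
under eq_bigr do rewrite sum_sqdist.
rewrite big_split/= -mulr_sumr -[\sum_i S i i]/(\tr S) trS sumr_const card_ord.
by rewrite -mulr_natr; ring.
Qed.

Lemma sum_mean_diff i : \sum_j (mu i 0 - mu j 0) = n%:R * mu i 0.
Proof.
have [_ _ mu0 _ _] := hN.
by rewrite sumrB mu0 subr0 sumr_const card_ord mulr_natl.
Qed.

End Normalized.

Lemma sqdist_diag S i : sqdist S i i = 0.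
Proof. by rewrite /sqdist; ring. Qed.

(** Summing over [j] recovers the means and the variances; the definition of [sqdist] then yields
    the other entries. *)
Lemma probit_determined (mu mu' : 'cV[R]_n) S S' : (0 < n)%N ->
  probit_normalized mu S -> probit_normalized mu' S' ->
  (forall i j, sqdist S i j = sqdist S' i j) ->
  (forall i j, mu i 0 - mu j 0 = mu' i 0 - mu' j 0) ->
  mu = mu' /\ S = S'.
Proof.
move=> n0 hN hN' q m.
have nR : n%:R != 0 :> R by rewrite pnatr_eq0 -lt0n.
split.
  apply/colP => i; apply: (mulfI nR).
  by rewrite -(sum_mean_diff hN) -(sum_mean_diff hN'); apply: eq_bigr.
have d i : S i i = S' i i.
  apply: (mulfI nR); apply: (@addIr _ n%:R).
  by rewrite -(sum_sqdist hN) -(sum_sqdist hN'); apply: eq_bigr.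
apply/matrixP => i j; have := q i j; rewrite /sqdist !d; lra.
Qed.
End CovarianceGeometry.

(** * Similar triangles and propagation of the scale *)

Section Similarity.
Context {R : realType}.

Lemma sqr_correlation (a b c : R) : 0 < a -> 0 < b ->
  (c / (Num.sqrt a * Num.sqrt b)) ^+ 2 = c ^+ 2 / (a * b).
Proof. by move=> a0 b0; rewrite expr_div_n exprMn !sqr_sqrtr// ltW. Qed.

(* Triangles with squared sides a, b, e and a', b', e' and two equal angles; the
   quantity [a b - c^2] is 4 times the squared area, whichever angle is used. *)
Lemma similar_triangles (a b e a' b' e' : R) :
  0 < a -> 0 < b -> 0 < e -> 0 < a' -> 0 < b' -> 0 < e' ->
  ((e - a - b) / 2) ^+ 2 < a * b ->
  (e - a - b) / 2 / (Num.sqrt a * Num.sqrt b) =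
    (e' - a' - b') / 2 / (Num.sqrt a' * Num.sqrt b') ->
  (b - a - e) / 2 / (Num.sqrt a * Num.sqrt e) =
    (b' - a' - e') / 2 / (Num.sqrt a' * Num.sqrt e') ->
  b' / b = e' / e.
Proof.
move=> a0 b0 e0 a0' b0' e0' D0 /(congr1 (fun x => x ^+ 2)) E1.
move=> /(congr1 (fun x => x ^+ 2)); move: E1; rewrite !sqr_correlation// => E1 E2.
set D := a * b - ((e - a - b) / 2) ^+ 2.
set D' := a' * b' - ((e' - a' - b') / 2) ^+ 2.
have ne : [/\ a != 0, b != 0, e != 0 & [/\ a' != 0, b' != 0 & e' != 0]].
  by split; [rewrite gt_eqF..|split; rewrite gt_eqF].
have [an bn en [an' bn' en']] := ne.
have sub1 (x y z : R) : y != 0 -> x = y - z -> x / y = 1 - z / y.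
  by move=> y0 ->; field.
(* [F1] and [F2] equate the squared sines of the two known angles. *)
have F1 : D / (a * b) = D' / (a' * b').
  rewrite (sub1 D (a * b) _ _ erefl) ?mulf_neq0// E1.
  by rewrite (sub1 D' (a' * b') _ _ erefl) ?mulf_neq0.
have F2 : D / (a * e) = D' / (a' * e').
  rewrite (sub1 D (a * e) (((b - a - e) / 2) ^+ 2)) ?mulf_neq0//; last first.
    by rewrite /D; field.
  rewrite (sub1 D' (a' * e') (((b' - a' - e') / 2) ^+ 2)) ?mulf_neq0//; last first.
    by rewrite /D'; field.
  by rewrite E2.
have Dn : D != 0 by rewrite gt_eqF// subr_gt0.
have G1 : D' = D / (a * b) * (a' * b') by rewrite F1 divfK// mulf_neq0.
have G2 : D' = D / (a * e) * (a' * e') by rewrite F2 divfK// mulf_neq0.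
(* After multiplication by the nonzero [D / a * a'] both sides equal [D']. *)
apply: (@mulfI _ (D / a * a')); first by rewrite !mulf_neq0// invr_eq0.
transitivity D'; [rewrite G1|rewrite G2]; field; first by rewrite an bn.
by rewrite an en.
Qed.

(** Consecutive pairs in the chain [{i, j}], [{i, k}], [{k, l}] share an index, and such pairs have
    equal ratios. *)
Lemma constant_ratio (n : nat) (r : 'I_n -> 'I_n -> R) :
  (forall i j, r i j = r j i) ->
  (forall i j k, i != j -> j != k -> i != k -> r j k = r i k) ->
  forall i j k l, i != j -> k != l -> r i j = r k l.
Proof.
move=> rC r3.
have adj i j k : i != k -> j != k -> r i k = r j k.
  move=> ik jk; have [->//|ij] := eqVneq i j.
  by apply: r3; rewrite // eq_sym.
move=> i j k l ij; have [<- il|ik kl] := eqVneq i k.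
  by rewrite rC (rC i l); apply: adj; rewrite eq_sym.
have -> : r i j = r k i by rewrite rC; apply: adj; rewrite // eq_sym.
by rewrite rC (rC k l); apply: adj; rewrite // eq_sym.
Qed.

End Similarity.

(** * Ranking probabilities of the probit model *)

Section ProbitProbabilities.
Context {R : realType} {n : nat}.
Variables (mu : 'cV[R]_n) (S : 'M[R]_n).
Hypotheses (n0 : (0 < n)%N) (hN : probit_normalized mu S).
Context {d : measure_display} {T : measurableType d} (P : probability T R).
Variable X : 'I_n -> T -> R.
Hypothesis hX : is_mvnormal P X mu S.
Implicit Types i j k : 'I_n.

Let mX i : measurable_fun setT (X i). Proof. by case: hX. Qed.

Lemma mvnormal_diff_law i j k (s t : R) (A : set R) : measurable A ->
  P ((fun w => s * (X i w - X j w) + t * (X j w - X k w)) @^-1` A) =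
  gauss_law (s * (mu i 0 - mu j 0) + t * (mu j 0 - mu k 0))
    (s ^+ 2 * sqdist S i j + 2 * s * t * sqcov S i j k + t ^+ 2 * sqdist S j k) A.
Proof.
move=> mA; rewrite -(bilform_dvec _ _ _ _ _ (probit_sym hN)).
rewrite -(lincomb_dvec i j k s t (fun l => mu l 0)).
have [_ law] := hX; have := law (s *: dvec i j + t *: dvec j k) A mA.
rewrite -/(bilform S _ _) mxE.
under [in X in gauss_law X _ _]eq_bigr do rewrite mxE.
move=> <-; congr (P (_ @^-1` A)); apply/funext => w.
by rewrite (lincomb_dvec i j k s t (fun l => X l w)).
Qed.

Lemma mvnormal_diff_law1 i j (A : set R) : measurable A ->
  P ((fun w => X i w - X j w) @^-1` A) =
  gauss_law (mu i 0 - mu j 0) (sqdist S i j) A.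
Proof.
move=> mA; have := mvnormal_diff_law i j j 1 0 mA.
rewrite !(mul0r, mulr0, addr0, mul1r, expr0n, expr1n).
by move=> <-; congr (P (_ @^-1` A)); apply/funext => w; ring.
Qed.

Lemma prob3_quadrant i j k : i != j -> j != k -> i != k ->
  prob3 P X i j k =
  quadrant_prob (sqcov S i j k / (Num.sqrt (sqdist S i j) * Num.sqrt (sqdist S j k)))
    ((mu i 0 - mu j 0) / Num.sqrt (sqdist S i j))
    ((mu j 0 - mu k 0) / Num.sqrt (sqdist S j k)).
Proof.
move=> ij jk ik.
have mD a b : measurable_fun setT (fun w => X a w - X b w).
  exact: measurable_funB.
rewrite -(bivariate_quadrant (mD i j) (mD j k) (mvnormal_diff_law i j k)
  (sqdist_gt0 n0 hN ij) (sqdist_gt0 n0 hN jk) (sqcov_lt n0 hN ij jk ik)).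
by rewrite /prob3; congr (P _); apply/seteqP; split => w /=; rewrite !subr_ge0.
Qed.

Lemma probability_setU_null (A B N : set T) : measurable A -> measurable B ->
  measurable N -> A `&` B `<=` N -> P N = 0%E -> P (A `|` B) = (P A + P B)%E.
Proof.
move=> mA mB mN ABN PN.
have PAB : P (A `&` B) = 0%E.
  apply/eqP; rewrite eq_le measure_ge0 andbT -PN.
  by apply: le_measure; rewrite ?inE//; exact: measurableI.
have -> : P B = (P (B `\` A) + P (B `&` A))%E by exact: measureDI.
rewrite setIC PAB adde0 -measureU//; [|exact: measurableD|].
  by congr (P _); rewrite setDE setUIr setUv setIT.
by apply/seteqP; split => // x [? []].
Qed.

Let mle i j : measurable [set w | X j w <= X i w].
Proof.
have -> : [set w | X j w <= X i w] = (fun w => X i w - X j w) @^-1` [set` `[0, +oo[].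
  by apply/seteqP; split => w /=; rewrite in_itv/= andbT subr_ge0.
have mf : measurable_fun setT (fun w => X i w - X j w) by exact: measurable_funB.
by rewrite -[X in measurable X]setTI; exact: mf.
Qed.

Let tie i j := (fun w => X i w - X j w) @^-1` [set (0 : R)].

Let mtie i j : measurable (tie i j).
Proof.
have mf : measurable_fun setT (fun w => X i w - X j w) by exact: measurable_funB.
by rewrite -[X in measurable X]setTI; exact: mf.
Qed.

Let tie0 i j : i != j -> P (tie i j) = 0%E.
Proof.
move=> ij; rewrite /tie mvnormal_diff_law1//.
exact: (gauss_law_set1 _ _ (sqdist_gt0 n0 hN ij)).
Qed.

(** With [i] above [j], the third alternative [k] comes last, between them or first; these events
    overlap only on ties, which are null. *)
Lemma prob_pair_prob3 i j k : i != j -> j != k -> i != k ->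
  P [set w | X j w <= X i w] =
  (prob3 P X i j k + prob3 P X i k j + prob3 P X k i j)%E.
Proof.
move=> ij jk ik.
have m3 a b c : measurable [set w | X b w <= X a w /\ X c w <= X b w].
  exact: (measurableI _ _ (mle a b) (mle b c)).
rewrite /prob3 -(probability_setU_null _ _ (mtie j k))//; last 2 first.
- move=> w [[? ?] [? ?]]; rewrite /tie/=; lra.
- exact: tie0.
rewrite -(probability_setU_null _ _ (mtie i k))//; last 3 first.
- exact: measurableU.
- by move=> w [[[? ?]|[? ?]] [? ?]]; rewrite /tie/=; lra.
- exact: tie0.
congr (P _); apply/seteqP; split => w /=; last by move=> [[]|]; lra.
move=> h; have [h1|h1] := lerP (X k w) (X j w); first by left; left; split.
have [h2|h2] := lerP (X k w) (X i w); first by left; right; split=> //; exact: ltW.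
by right; split=> //; exact: ltW.
Qed.

Lemma prob_pair i j : i != j -> P [set w | X j w <= X i w] =
  normal_prob 0 1 [set` `[- ((mu i 0 - mu j 0) / Num.sqrt (sqdist S i j)), +oo[].
Proof.
move=> ij; rewrite -(gauss_law_halfline _ (sqdist_gt0 n0 hN ij)).
rewrite -mvnormal_diff_law1//; congr (P _).
by apply/seteqP; split => w /=; rewrite in_itv/= andbT subr_ge0.
Qed.

End ProbitProbabilities.

(** * Identifiability from three-way probabilities *)

Lemma ord_neq2 (n : nat) (i j : 'I_n) : (3 <= n)%N -> exists k, (k != i) && (k != j).
Proof.
move=> n3; apply/existsP; rewrite -[X in is_true X]negbK negb_exists.
apply/negP => /forallP h.
have : (#|'I_n| <= #|pred2 i j|)%N.
  apply: subset_leq_card; apply/fintype.subsetP => k _; rewrite !inE.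
  by have := h k; rewrite negb_and !negbK.
by rewrite card_ord card2 leqNgt (leq_trans _ n3)// ltnS; case: (i != j).
Qed.

Unset Implicit Arguments.

Theorem theorem3 (R : realType) (n : nat) (hn : (3 <= n)%N)
    (mu mu' : 'cV[R]_n) (Sigma Sigma' : 'M[R]_n)
    (hN : probit_normalized mu Sigma) (hN' : probit_normalized mu' Sigma')
    (d : measure_display) (T : measurableType d) (P : probability T R)
    (X : 'I_n -> T -> R) (hX : is_mvnormal P X mu Sigma)
    (d' : measure_display) (T' : measurableType d') (P' : probability T' R)
    (X' : 'I_n -> T' -> R) (hX' : is_mvnormal P' X' mu' Sigma')
    (h3 : forall i j k : 'I_n, i != j -> j != k -> i != k ->
            prob3 P X i j k = prob3 P' X' i j k) :
  mu = mu' /\ Sigma = Sigma'.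
Proof.
have n0 : (0 < n)%N by exact: leq_trans hn.
pose q := sqdist Sigma; pose q' := sqdist Sigma'.
have qp i j : i != j -> 0 < q i j by exact: (sqdist_gt0 n0 hN).
have qp' i j : i != j -> 0 < q' i j by exact: (sqdist_gt0 n0 hN').
have qC i j : q i j = q j i by exact: (sqdistC _ _ (probit_sym hN)).
have qC' i j : q' i j = q' j i by exact: (sqdistC _ _ (probit_sym hN')).
(* Pair probabilities are sums of three-way ones, and the standard normal tail determines its
   threshold. *)
have scaled_mean i j : i != j ->
    (mu i 0 - mu j 0) / Num.sqrt (sqdist Sigma i j) =
    (mu' i 0 - mu' j 0) / Num.sqrt (sqdist Sigma' i j).
  move=> ij; have [k /andP[ki kj]] := ord_neq2 i j hn.
  have jk : j != k by rewrite eq_sym.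
  have ik : i != k by rewrite eq_sym.
  apply: normal_halfline_inj.
  rewrite -(prob_pair n0 hN hX ij) -(prob_pair n0 hN' hX' ij).
  rewrite (prob_pair_prob3 n0 hN hX ij jk ik) (prob_pair_prob3 n0 hN' hX' ij jk ik).
  by rewrite !h3// eq_sym.
(* With equal thresholds on both sides, injectivity of [quadrant_prob] in the correlation
   applies. *)
have correlation i j k : i != j -> j != k -> i != k ->
    sqcov Sigma i j k / (Num.sqrt (q i j) * Num.sqrt (q j k)) =
    sqcov Sigma' i j k / (Num.sqrt (q' i j) * Num.sqrt (q' j k)).
  move=> ij jk ik; have := h3 i j k ij jk ik.
  rewrite (prob3_quadrant n0 hN hX ij jk ik) (prob3_quadrant n0 hN' hX' ij jk ik).
  rewrite (scaled_mean _ _ ij) (scaled_mean _ _ jk).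
  apply: quadrant_prob_inj.
    exact: correlation_itv (qp _ _ ij) (qp _ _ jk) (sqcov_lt n0 hN ij jk ik).
  exact: correlation_itv (qp' _ _ ij) (qp' _ _ jk) (sqcov_lt n0 hN' ij jk ik).
have ratio : forall i j k l, i != j -> k != l -> q' i j / q i j = q' k l / q k l.
  apply: (constant_ratio (r := fun i j => q' i j / q i j)).
    by move=> i j; rewrite qC qC'.
  move=> i j k ij jk ik; have ji : j != i by rewrite eq_sym.
  apply: (similar_triangles (qp _ _ ij) (qp _ _ jk) (qp _ _ ik)
    (qp' _ _ ij) (qp' _ _ jk) (qp' _ _ ik)).
  - exact: (sqcov_lt n0 hN ij jk ik).
  - exact: (correlation i j k ij jk ik).
  (* The previous angle was the one at [j]; this one is at [i]. *)
  - have := correlation j i k ji ik jk; rewrite /sqcov -/q -/q'.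
    by rewrite (qC j i) (qC' j i).
pose lam := q' (Ordinal (leq_trans (isT : 0 < 3)%N hn))
               (Ordinal (leq_trans (isT : 1 < 3)%N hn)) /
            q (Ordinal (leq_trans (isT : 0 < 3)%N hn))
              (Ordinal (leq_trans (isT : 1 < 3)%N hn)).
have q'E i j : q' i j = lam * q i j.
  have [->|ij] := eqVneq i j; first by rewrite /q /q' !sqdist_diag mulr0.
  by rewrite /lam -(ratio i j) // divfK// gt_eqF// qp.
(* Both families of squared distances have the same nonzero total, so the common ratio is 1. *)
have lam1 : lam = 1.
  have := sum_sum_sqdist hN'; rewrite -/q'.
  under eq_bigr do under eq_bigr do rewrite q'E.
  under eq_bigr do rewrite -mulr_sumr.
  rewrite -mulr_sumr (sum_sum_sqdist hN) -[RHS]mul1r; apply: mulIf.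
  by rewrite mulf_neq0 ?pnatr_eq0// expf_neq0// pnatr_eq0 -lt0n.
have qE i j : q i j = q' i j by rewrite q'E lam1 mul1r.
apply: (probit_determined n0 hN hN' qE) => i j.
have [->|ij] := eqVneq i j; first by rewrite !subrr.
have := scaled_mean i j ij; rewrite -/(q i j) -/(q' i j) qE; apply: mulIf.
by rewrite invr_eq0 gt_eqF// sqrtr_gt0 qp'.
Qed.
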